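(* Let $\Delta t>0$ be arbitrary, and let $\{Z^n\}_{n\ge 0}$, $\{W^{n+1/2}\}_{n\ge 0}$, $\{R^n\}_{n\ge 0}$ satisfy the SAV/CN-BCFD scheme for the $L^2$ gradient flow: for all $n\ge 0$, $1\le i\le N_x$, $1\le j\le N_y$, $$[d_tZ]_{i,j}^{n+1}=-M\,W_{i,j}^{n+1/2},$$ $$W_{i,j}^{n+1/2}=-[D_xd_xZ+D_yd_yZ]_{i,j}^{n+1/2}+\lambda Z_{i,j}^{n+1/2}+\frac{R^{n+1/2}}{\sqrt{E_1^h(\tilde Z^{n+1/2})}}F'(\tilde Z_{i,j}^{n+1/2}),$$ $$d_tR^{n+1}=\frac{1}{2\sqrt{E_1^h(\tilde Z^{n+1/2})}}\left(F'(\tilde Z^{n+1/2}),d_tZ^{n+1}\right)_m,$$ with the homogeneous discrete Neumann boundary conditions for $Z$ and $W$. Then the scheme is unconditionally stable, in the sense that for any $\Delta t$ the following discrete energy law holds: $$\frac{1}{\Delta t}\left[E_d(Z^{n+1})-E_d(Z^n)\right]=-M\|W^{n+1/2}\|_{m}^2,\qquad \forall n\ge 0,$$ where $E_d(Z^n)=\frac{\lambda}{2}\|Z^n\|_m^2+\frac12\|\mathbf{d}Z^n\|_{TM}^2+(R^n)^2$.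
   Context: Constants: $M>0$, $\lambda\ge 0$. $F:\mathbb{R}\to\mathbb{R}$ is a differentiable free energy density such that $E_1(\phi)=\int_\Omega F(\phi)\,d\mathbf{x}\ge C_0>0$ for all $\phi$ (a constant having been added to $E_1$ if necessary), so that the square roots below are of positive numbers. Grid: $\Omega\subset\mathbb{R}^2$ is a rectangle divided into $N_x\times N_y$ uniform cells with grid lines $x_{i+1/2}$ ($0\le i\le N_x$), $y_{j+1/2}$ ($0\le j\le N_y$), spacings $h_x=x_{i+1/2}-x_{i-1/2}$, $h_y=y_{j+1/2}-y_{j-1/2}$, and cell centers $(x_i,y_j)$, $x_i=(x_{i-1/2}+x_{i+1/2})/2$, $y_j=(y_{j-1/2}+y_{j+1/2})/2$, $1\le i\le N_x$, $1\le j\le N_y$. Cell-centered grid functions are arrays $(g_{i,j})$. Difference operators: $[d_xg]_{i+1/2,j}=(g_{i+1,j}-g_{i,j})/h_x$, $[d_yg]_{i,j+1/2}=(g_{i,j+1}-g_{i,j})/h_y$ at interior faces; $[D_xg]_{i,j}=(g_{i+1/2,j}-g_{i-1/2,j})/h_x$, $[D_yg]_{i,j}=(g_{i,j+1/2}-g_{i,j-1/2})/h_y$; $[d_tg]^n=(g^n-g^{n-1})/\Delta t$; $\mathbf{d}g=(d_xg,d_yg)$. Discrete Neumann boundary conditions for a cell-centered function $g$ mean that $[d_xg]_{1/2,j}=[d_xg]_{N_x+1/2,j}=0$ for $1\le j\le N_y$ and $[d_yg]_{i,1/2}=[d_yg]_{i,N_y+1/2}=0$ for $1\le i\le N_x$;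 these boundary values are used when evaluating $D_xd_xg$ and $D_yd_yg$. Inner products: $(f,g)_m=\sum_{i=1}^{N_x}\sum_{j=1}^{N_y}h_xh_yf_{i,j}g_{i,j}$; $(f,g)_x=\sum_{i=1}^{N_x-1}\sum_{j=1}^{N_y}h_xh_yf_{i+1/2,j}g_{i+1/2,j}$; $(f,g)_y=\sum_{i=1}^{N_x}\sum_{j=1}^{N_y-1}h_xh_yf_{i,j+1/2}g_{i,j+1/2}$; $(\mathbf v,\mathbf r)_{TM}=(v_1,r_1)_x+(v_2,r_2)_y$; $\|\cdot\|_m,\|\cdot\|_{TM}$ are the induced norms. Scheme notation: $Z^n$ is a cell-centered grid function and $R^n\in\mathbb{R}$ for each integer $n\ge 0$; $Z^{n+1/2}=\frac12(Z^n+Z^{n+1})$, $R^{n+1/2}=\frac12(R^n+R^{n+1})$; $W^{n+1/2}$ is a cell-centered grid function (an unknown of the scheme at the half level); $\tilde Z^{n+1/2}$ is any given (explicitly computed) cell-centered grid function, e.g. $\frac12(3Z^n-Z^{n-1})$; $E_1^h(\tilde Z)=\sum_{i=1}^{N_x}\sum_{j=1}^{N_y}h_xh_yF(\tilde Z_{i,j})$. The boundary conditions are imposed on every $Z^n$ and on every $W^{n+1/2}$ (for $W$ they are only a convention for the boundary-face values and do not enter the equations above). *)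

(* Defs.v *)
From mathcomp Require Import all_boot all_order all_algebra.
From mathcomp Require Import all_classical all_reals all_analysis.
Import Order.TTheory GRing.Theory Num.Theory.
Import numFieldNormedType.Exports.

Set Implicit Arguments.
Unset Strict Implicit.
Unset Printing Implicit Defensive.

Local Open Scope classical_set_scope.
Local Open Scope ring_scope.

(* Cell (i, j), 1 <= i <= Nx, 1 <= j <= Ny, carries the value [g i j].  The
   layers i = 0, i = Nx + 1, j = 0, j = Ny + 1 are ghost cells: their only role
   is to give d_x g and d_y g a value on the boundary faces, so that a boundary
   condition can be stated as a condition on that value.  They never enter the
   inner products, and all other values of [g] are never used.
   Half-integer indices are rounded down: grid line, x-face and y-face number
   i stands for x_{i+1/2}, (i+1/2, j) and (i, j+1/2) respectively. *)
Definition gridfun (R : Type) := nat -> nat -> R.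

Definition uniform_lines (R : realType) (N : nat) (x : nat -> R) (h : R) :=
  0 < h /\ forall i, (i < N)%N -> x i.+1 - x i = h.

Definition rectangle (R : realType) (Nx Ny : nat) (x y : nat -> R) :
  set (R * R) := `[x 0%N, x Nx] `*` `[y 0%N, y Ny].

Section Operators.
Context {R : realType}.
Implicit Types (g v : gridfun R) (h : R).

Definition dx h g : gridfun R := fun i j => (g i.+1 j - g i j) / h.
Definition dy h g : gridfun R := fun i j => (g i j.+1 - g i j) / h.

(* Meant for i >= 1, resp. j >= 1. *)
Definition Dx h v : gridfun R := fun i j => (v i j - v i.-1 j) / h.
Definition Dy h v : gridfun R := fun i j => (v i j - v i j.-1) / h.

Definition neumann (Nx Ny : nat) hx hy g :=
  (forall j, (1 <= j <= Ny)%N -> dx hx g 0%N j = 0 /\ dx hx g Nx j = 0) /\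
  (forall i, (1 <= i <= Nx)%N -> dy hy g i 0%N = 0 /\ dy hy g i Ny = 0).

(* Backward difference quotient, meant for n >= 1. *)
Definition dt (tau : R) (u : nat -> R) (n : nat) : R := (u n - u n.-1) / tau.
Definition dtg (tau : R) (u : nat -> gridfun R) (n : nat) : gridfun R :=
  fun i j => dt tau (fun k => u k i j) n.

(* Value at the half level n + 1/2. *)
Definition mid (u : nat -> R) (n : nat) : R := (u n + u n.+1) / 2.
Definition midg (u : nat -> gridfun R) (n : nat) : gridfun R :=
  fun i j => mid (fun k => u k i j) n.

End Operators.

Section Products.
Context {R : realType} (Nx Ny : nat) (hx hy : R).
Implicit Types f g : gridfun R.

Definition ip_m f g : R :=
  \sum_(1 <= i < Nx.+1) \sum_(1 <= j < Ny.+1) hx * hy * f i j * g i j.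

(* The products on faces range over interior faces only. *)
Definition ip_x f g : R :=
  \sum_(1 <= i < Nx) \sum_(1 <= j < Ny.+1) hx * hy * f i j * g i j.
Definition ip_y f g : R :=
  \sum_(1 <= i < Nx.+1) \sum_(1 <= j < Ny) hx * hy * f i j * g i j.
Definition ip_TM (v r : gridfun R * gridfun R) : R :=
  ip_x v.1 r.1 + ip_y v.2 r.2.

Definition norm_m f : R := Num.sqrt (ip_m f f).
Definition norm_TM (v : gridfun R * gridfun R) : R := Num.sqrt (ip_TM v v).

Definition grad g : gridfun R * gridfun R := (dx hx g, dy hy g).

Definition E1h (F : R -> R) g : R :=
  \sum_(1 <= i < Nx.+1) \sum_(1 <= j < Ny.+1) hx * hy * F (g i j).

Definition Ed (lambda : R) g (r : R) : R :=
  lambda / 2 * norm_m g ^+ 2 + 1 / 2 * norm_TM (grad g) ^+ 2 + r ^+ 2.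

End Products.

Section ContinuousEnergy.
Context {R : realType}.

Definition lebesgue2 := (@lebesgue_measure R \x @lebesgue_measure R)%E.

Definition E1 (Omega : set (R * R)) (F : R -> R) (phi : R * R -> R) : R :=
  \int[lebesgue2]_(p in Omega) F (phi p).

(* The functions phi on Omega whose energy E1 is a well-defined real number. *)
Definition finite_energy (Omega : set (R * R)) (F : R -> R)
    (phi : R * R -> R) :=
  measurable_fun Omega phi /\
  lebesgue2.-integrable Omega (fun p => (F (phi p))%:E).

End ContinuousEnergy.

(* Main.v *)
Require Import Defs.
From mathcomp Require Import all_boot all_order all_algebra.
From mathcomp Require Import all_classical all_reals all_analysis.
From mathcomp Require Import ring.
Import Order.TTheory GRing.Theory Num.Theory.
Import numFieldNormedType.Exports.
Local Open Scope ring_scope.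

Set Implicit Arguments.
Unset Strict Implicit.

(* Pair both scheme equations with the m-inner product: (d_t Z, W)_m is
   -M |W|_m^2 by the first one.  By the second one it is the discrete time
   derivative of the energy, because a midpoint value times a difference
   quotient is a difference of squares, the Neumann condition kills the boundary
   terms of the summation by parts, and the nonlinear term is 2 R d_t R at the
   half level by the third equation. *)

(** Abel summation, by induction on [N]. The right boundary term stays explicit because [v N = 0]
    would not pass to smaller [N]. *)
Lemma sum_by_parts (R : comPzRingType) (N : nat) (v u : nat -> R) :
  v 0%N = 0 ->
  \sum_(1 <= i < N.+1) (v i - v i.-1) * u i
  = v N * u N - \sum_(1 <= i < N) v i * (u i.+1 - u i).
Proof.
move=> v0; elim: N => [|N IHN]; first by rewrite !big_geq // v0; ring.
rewrite big_nat_recr //= IHN.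
(* The sum on the right has a last term to split off only when it is nonempty; in the empty case
   [v0] closes the goal. *)
case: N {IHN} => [|N]; first by rewrite !big_geq // v0; ring.
by rewrite [in RHS]big_nat_recr //=; ring.
Qed.

Section Pairings.
Context {R : realType} (Nx Ny : nat) (hx hy : R).
Implicit Types f g v : gridfun R.

Local Notation ip_m := (ip_m Nx Ny hx hy).
Local Notation ip_x := (ip_x Nx Ny hx hy).
Local Notation ip_y := (ip_y Nx Ny hx hy).

(** The scheme equations hold on the true cells only, so they enter the pairing through this lemma
    and not as equalities of grid functions. *)
Lemma eq_ip_m f f' g g' :
  (forall i j, (1 <= i <= Nx)%N -> (1 <= j <= Ny)%N -> f i j = f' i j) ->
  (forall i j, (1 <= i <= Nx)%N -> (1 <= j <= Ny)%N -> g i j = g' i j) ->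
  ip_m f g = ip_m f' g'.
Proof.
move=> eqf eqg; apply: eq_big_nat => i Hi; apply: eq_big_nat => j Hj.
by rewrite eqf // eqg.
Qed.

Lemma ip_mDl f f' g :
  ip_m (fun i j => f i j + f' i j) g = ip_m f g + ip_m f' g.
Proof.
rewrite -big_split; apply: eq_bigr => i _ /=.
by rewrite -big_split; apply: eq_bigr => j _ /=; ring.
Qed.

Lemma ip_mZl (a : R) f g : ip_m (fun i j => a * f i j) g = a * ip_m f g.
Proof.
rewrite /Defs.ip_m mulr_sumr; apply: eq_bigr => i _.
by rewrite mulr_sumr; apply: eq_bigr => j _; ring.
Qed.

Lemma ip_m_Dx v g :
  (forall j, (1 <= j <= Ny)%N -> v 0%N j = 0 /\ v Nx j = 0) ->
  ip_m (Dx hx v) g = - ip_x v (dx hx g).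
Proof.
move=> v_bd; rewrite /Defs.ip_m /Defs.ip_x exchange_big_nat /=.
rewrite [in RHS]exchange_big_nat /= -sumrN; apply: eq_big_nat => j Hj.
have [v0 vN] := v_bd j Hj.
(* The factor [hx^-1] just moves from [Dx] to [dx]; leaving [hx * hy / hx] unreduced lets [ring]
   work without [hx != 0]. *)
transitivity (\sum_(1 <= i < Nx.+1)
    (v i j - v i.-1 j) * (hx * hy / hx * g i j)).
  by apply: eq_bigr => i _; rewrite /Dx; ring.
rewrite (@sum_by_parts R _ (v^~ j) (fun i => hx * hy / hx * g i j) v0).
rewrite vN mul0r sub0r; congr (- _).
by apply: eq_bigr => i _; rewrite /dx; ring.
Qed.

Lemma ip_m_Dy v g :
  (forall i, (1 <= i <= Nx)%N -> v i 0%N = 0 /\ v i Ny = 0) ->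
  ip_m (Dy hy v) g = - ip_y v (dy hy g).
Proof.
move=> v_bd; rewrite /Defs.ip_m /Defs.ip_y -sumrN; apply: eq_big_nat => i Hi.
have [v0 vN] := v_bd i Hi.
transitivity (\sum_(1 <= j < Ny.+1)
    (v i j - v i j.-1) * (hx * hy / hy * g i j)).
  by apply: eq_bigr => j _; rewrite /Dy; ring.
rewrite (@sum_by_parts R _ (v i) (fun j => hx * hy / hy * g i j) v0).
rewrite vN mul0r sub0r; congr (- _).
by apply: eq_bigr => j _; rewrite /dy; ring.
Qed.

Section Nonnegative.
Hypotheses (hx_ge0 : 0 <= hx) (hy_ge0 : 0 <= hy).

(** [Num.sqrt] is 0 on negative numbers, so squaring undoes it only because each summand is a
    nonnegative area times a square. *)
Lemma sqr_norm_m f : norm_m Nx Ny hx hy f ^+ 2 = ip_m f f.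
Proof.
rewrite sqr_sqrtr //; apply: sumr_ge0 => i _; apply: sumr_ge0 => j _.
by rewrite -mulrA -expr2 mulr_ge0 ?sqr_ge0 // mulr_ge0.
Qed.

Lemma sqr_norm_TM (v : gridfun R * gridfun R) :
  norm_TM Nx Ny hx hy v ^+ 2 = ip_x v.1 v.1 + ip_y v.2 v.2.
Proof.
rewrite sqr_sqrtr //; apply: addr_ge0.
all: apply: sumr_ge0 => i _; apply: sumr_ge0 => j _.
all: by rewrite -mulrA -expr2 mulr_ge0 ?sqr_ge0 // mulr_ge0.
Qed.

End Nonnegative.

Section TimeStep.
Variables (tau : R) (Z : nat -> gridfun R) (n : nat).

(** Cell by cell, this is (a + b)/2 * (b - a)/tau = (b^2 - a^2)/(2 tau). The two face versions below
    follow in the same way, [dx] and [dy] being linear. *)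
Lemma ip_m_mid_dt :
  ip_m (midg Z n) (dtg tau Z n.+1)
  = (ip_m (Z n.+1) (Z n.+1) - ip_m (Z n) (Z n)) / (2 * tau).
Proof.
rewrite -sumrB mulr_suml; apply: eq_bigr => i _.
rewrite -sumrB mulr_suml; apply: eq_bigr => j _.
by rewrite /midg /mid /dtg /dt /= invfM; ring.
Qed.

Lemma ip_x_mid_dt :
  ip_x (dx hx (midg Z n)) (dx hx (dtg tau Z n.+1))
  = (ip_x (dx hx (Z n.+1)) (dx hx (Z n.+1))
     - ip_x (dx hx (Z n)) (dx hx (Z n))) / (2 * tau).
Proof.
rewrite -sumrB mulr_suml; apply: eq_bigr => i _.
rewrite -sumrB mulr_suml; apply: eq_bigr => j _.
by rewrite /dx /midg /mid /dtg /dt /= invfM; ring.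
Qed.

Lemma ip_y_mid_dt :
  ip_y (dy hy (midg Z n)) (dy hy (dtg tau Z n.+1))
  = (ip_y (dy hy (Z n.+1)) (dy hy (Z n.+1))
     - ip_y (dy hy (Z n)) (dy hy (Z n))) / (2 * tau).
Proof.
rewrite -sumrB mulr_suml; apply: eq_bigr => i _.
rewrite -sumrB mulr_suml; apply: eq_bigr => j _.
by rewrite /dy /midg /mid /dtg /dt /= invfM; ring.
Qed.

(** Supplies the vanishing boundary fluxes that [ip_m_Dx] and [ip_m_Dy] require of the midpoint
    value. *)
Lemma neumann_midg :
  neumann Nx Ny hx hy (Z n) -> neumann Nx Ny hx hy (Z n.+1) ->
  neumann Nx Ny hx hy (midg Z n).
Proof.
have Ex i j : dx hx (midg Z n) i j = (dx hx (Z n) i j + dx hx (Z n.+1) i j) / 2.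
  by rewrite /dx /midg /mid; ring.
have Ey i j : dy hy (midg Z n) i j = (dy hy (Z n) i j + dy hy (Z n.+1) i j) / 2.
  by rewrite /dy /midg /mid; ring.
move=> [Zx Zy] [Z'x Z'y]; split=> k Hk; rewrite ?Ex ?Ey.
  by have [-> ->] := Zx k Hk; have [-> ->] := Z'x k Hk; rewrite addr0 mul0r.
by have [-> ->] := Zy k Hk; have [-> ->] := Z'y k Hk; rewrite addr0 mul0r.
Qed.

End TimeStep.

End Pairings.

Theorem theorem3 (R : realType) (M lambda : R) (M_gt0 : 0 < M)
  (lambda_ge0 : 0 <= lambda)
  (Nx Ny : nat) (Nx_gt0 : (0 < Nx)%N) (Ny_gt0 : (0 < Ny)%N)
  (x y : nat -> R) (hx hy : R)
  (x_uniform : uniform_lines Nx x hx) (y_uniform : uniform_lines Ny y hy)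
  (F : R -> R) (F_diff : forall s : R, derivable F s 1)
  (C0 : R) (C0_gt0 : 0 < C0)
  (E1_ge : forall phi : R * R -> R,
     finite_energy (rectangle Nx Ny x y) F phi ->
     C0 <= E1 (rectangle Nx Ny x y) F phi)
  (tau : R) (tau_gt0 : 0 < tau)
  (Z W Zt : nat -> gridfun R) (r : nat -> R)
  (Z_neumann : forall n, neumann Nx Ny hx hy (Z n))
  (W_neumann : forall n, neumann Nx Ny hx hy (W n))
  (schemeZ : forall n i j : nat, (1 <= i <= Nx)%N -> (1 <= j <= Ny)%N ->
     dtg tau Z n.+1 i j = - M * W n i j)
  (schemeW : forall n i j : nat, (1 <= i <= Nx)%N -> (1 <= j <= Ny)%N ->
     W n i j =
       - (Dx hx (dx hx (midg Z n)) i j + Dy hy (dy hy (midg Z n)) i j)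
       + lambda * midg Z n i j
       + mid r n / Num.sqrt (E1h Nx Ny hx hy F (Zt n)) * derive1 F (Zt n i j))
  (schemeR : forall n : nat,
     dt tau r n.+1 =
       1 / (2 * Num.sqrt (E1h Nx Ny hx hy F (Zt n)))
       * ip_m Nx Ny hx hy (fun i j => derive1 F (Zt n i j)) (dtg tau Z n.+1)) :
  forall n : nat,
    1 / tau * (Ed Nx Ny hx hy lambda (Z n.+1) (r n.+1)
               - Ed Nx Ny hx hy lambda (Z n) (r n))
    = - M * norm_m Nx Ny hx hy (W n) ^+ 2.
Proof.
move=> n; have [hx_gt0 _] := x_uniform; have [hy_gt0 _] := y_uniform.
have [mid_x mid_y] := neumann_midg (Z_neumann n) (Z_neumann n.+1).
set D := dtg tau Z n.+1.
set S := Num.sqrt (E1h Nx Ny hx hy F (Zt n)) in schemeR schemeW *.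
set dF : gridfun R := fun i j => derive1 F (Zt n i j).
have dissipation : ip_m Nx Ny hx hy (W n) D = - M * ip_m Nx Ny hx hy (W n) (W n).
  rewrite -ip_mZl.
  transitivity (ip_m Nx Ny hx hy (W n) (fun i j => - M * W n i j)).
    by apply: eq_ip_m => // i j; exact: schemeZ.
  by apply: eq_bigr => i _; apply: eq_bigr => j _; ring.
have expansion : ip_m Nx Ny hx hy (W n) D =
    ip_x Nx Ny hx hy (dx hx (midg Z n)) (dx hx D)
    + ip_y Nx Ny hx hy (dy hy (midg Z n)) (dy hy D)
    + lambda * ip_m Nx Ny hx hy (midg Z n) D
    + mid r n / S * ip_m Nx Ny hx hy dF D.
  (* The sign is written as [-1 *] so that [ip_mZl] extracts it like any other scalar. *)
  transitivity (ip_m Nx Ny hx hy (fun i j =>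
      (-1 * (Dx hx (dx hx (midg Z n)) i j + Dy hy (dy hy (midg Z n)) i j)
       + lambda * midg Z n i j) + mid r n / S * dF i j) D).
    by apply: eq_ip_m => // i j Hi Hj; rewrite mulN1r schemeW.
  by rewrite !(ip_mDl, ip_mZl) ip_m_Dx // ip_m_Dy //; ring.
have dr : mid r n / S * ip_m Nx Ny hx hy dF D = (r n.+1 ^+ 2 - r n ^+ 2) / tau.
  (* By [schemeR], the pairing of [dF] with [D] divided by [S] is twice [dt tau r n.+1]; a
     difference of squares remains. *)
  transitivity (2 * mid r n * dt tau r n.+1).
    (* With S^-1 as an atom, field does not ask for S != 0. *)
    by rewrite schemeR -/S -/D -/dF invfM; set Sinv := S^-1; field.
  by rewrite /mid /dt /=; field; rewrite gt_eqF.
(* Reading [dissipation] backwards turns the right-hand side into the pairing of [W n] with [D],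
   which [expansion] and [dr] then evaluate. *)
rewrite /Ed !sqr_norm_m ?sqr_norm_TM ?ltW //= -dissipation expansion dr.
rewrite /D ip_x_mid_dt ip_y_mid_dt ip_m_mid_dt.
by field; rewrite gt_eqF.
Qed.
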